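(* Let $F_L,F_R$ be probability distributions on $[0,1]$, let $p:[0,1]\to[0,1]$ be a measurable function, and let $X=\{X_n\}_{n\ge 0}$ be the Markov chain on $[0,1]$ described in the context. Suppose there is a single $\delta\in(0,1/2)$ for which the following three conditions all hold. (1) $\sup_{x\in[0,\delta]}\max\{p(x),\,1-p(1-x)\}<1$. (2) $\max\{F_L(1-\delta),\,F_R(1-\delta)\}<1$. (3) There exist $s,t\in(\delta,1-\delta)$ with $s<t$ such that $F_L$ has a density $f_L$ on the interval $(1-t-\delta,\,1-s)$ and $F_R$ has a density $f_R$ on the interval $(s-\delta,\,t)$, and, setting $$g(z):=\min\left\{\inf_{y\in[1-\delta,1]}f_L\left(\frac{y-z}{y}\right),\ \inf_{y\in[0,\delta]}f_R\left(\frac{z-y}{1-y}\right)\right\},\qquad z\in(s,t),$$ one has $\int_s^t g(z)\,dz>0$. Then the Markov chain $X$ is ergodic.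
   Context: The chain $X=\{X_n\}_{n\ge0}$ is defined by $X_0=x_0\in[0,1]$ and $$X_{n+1}=X_n-X_nL_{n+1}I_{n+1}+(1-X_n)R_{n+1}(1-I_{n+1}),\qquad n=0,1,\ldots,$$ where $I_{n+1}:=\mathbf{1}_{\{U_{n+1}<p(X_n)\}}$ ($\mathbf{1}_A$ is the indicator of the event $A$), and $\{L_n\}_{n\ge1}$, $\{R_n\}_{n\ge1}$, $\{U_n\}_{n\ge1}$ are independent sequences of i.i.d. random variables with $L_n\sim F_L$, $R_n\sim F_R$, and $U_n$ uniform on $[0,1]$. For a distribution $F$ on $[0,1]$, $F(x)$ denotes its distribution function, i.e. $F(x)=F([0,x])$. ''$F$ has a density $f$ on an interval $J$'' means that the restriction of the distribution $F$ to $J$ is absolutely continuous with respect to Lebesgue measure with density $f$. Ergodicity is meant in the usual sense for Harris chains: there is a unique stationary probability distribution $\Pi$ on $[0,1]$ and, for every starting point $x_0\in[0,1]$, the law of $X_n$ converges to $\Pi$ in total variation as $n\to\infty$. *)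

(* Defs.v *)
From mathcomp Require Export all_boot all_order all_algebra finmap.
From mathcomp Require Export all_classical all_reals all_analysis.
Set Implicit Arguments.
Unset Strict Implicit.
Unset Printing Implicit Defensive.
Import Order.TTheory GRing.Theory Num.Theory.
Import numFieldNormedType.Exports.

Local Open Scope classical_set_scope.
Local Open Scope ring_scope.

Definition mutually_independent d (T : measurableType d) (R : realType)
    (P : probability T R) (I : choiceType) (X : I -> {RV P >-> R}) : Prop :=
  forall (J : {fset I}) (B : I -> set R), (forall i, measurable (B i)) ->
    P (\bigcap_(i in [set` J]) (X i @^-1` B i)) =
    (\prod_(i <- J) P (X i @^-1` B i))%E.

Definition has_law d (T : measurableType d) (R : realType)
    (P : probability T R) (X : {RV P >-> R}) (F : set R -> \bar R) : Prop :=
  forall A : set R, measurable A -> distribution P X A = F A.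

(* Three sequences gathered into one family, so that joint independence of
   everything can be stated at once. *)
Definition gather3 (V : Type) (u v w : nat -> V) (i : nat + nat + nat) : V :=
  match i with
  | inl (inl n) => u n
  | inl (inr n) => v n
  | inr n => w n
  end.

(* [Ls n], [Rs n], [Us n] are the variables of index n + 1, i.e. those used in
   the transition from time n to time n + 1. *)
Definition driving_sequences d (T : measurableType d) (R : realType)
    (P : probability T R) (FL FR : probability (measurableTypeR R) R)
    (Ls Rs Us : nat -> {RV P >-> R}) : Prop :=
  [/\ forall n, has_law (Ls n) FL,
      forall n, has_law (Rs n) FR,
      forall n, has_law (Us n) (uniform_prob (@ltr01 R)) &
      mutually_independent (gather3 Ls Rs Us)].

(* [p] only matters on [0, 1]: the restriction sets it to 0 elsewhere, where
   the chain may go only on the null event that some [Ls n] or [Rs n] lies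
   outside [0, 1]. *)
Definition chain_step (R : realType) (p : R -> R) (x l r u : R) : R :=
  let i : R := (u < (p \_ `[0, 1]) x)%R%:R in
  x - x * l * i + (1 - x) * r * (1 - i).

Fixpoint chain (R : realType) (T : Type) (p : R -> R) (Ls Rs Us : nat -> T -> R)
    (x0 : R) (n : nat) (w : T) : R :=
  if n is m.+1 then
    chain_step p (chain p Ls Rs Us x0 m w) (Ls m w) (Rs m w) (Us m w)
  else x0.

Definition chain_law d (T : measurableType d) (R : realType)
    (P : probability T R) (p : R -> R) (Ls Rs Us : nat -> {RV P >-> R})
    (x0 : R) (n : nat) : set R -> \bar R :=
  pushforward P (chain p Ls Rs Us x0 n).

Definition tv_dist (R : realType) (mu nu : set R -> \bar R) : \bar R :=
  ereal_sup [set `|mu A - nu A|%E | A in [set A : set R | measurable A]].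

(* [law x n] is the law at time n of a Markov chain on [0, 1] started at x, so
   [law x 1] is its transition kernel. *)
Definition stationary (R : realType) (law : R -> nat -> set R -> \bar R)
    (Pi : probability (measurableTypeR R) R) : Prop :=
  Pi `[0, 1]%classic = 1%E /\
  forall A : set R, measurable A ->
    (\int[Pi]_(x in `[0%R, 1%R]) law x 1%N A)%E = Pi A.

Definition ergodic (R : realType) (law : R -> nat -> set R -> \bar R) : Prop :=
  exists Pi : probability (measurableTypeR R) R,
    [/\ stationary law Pi,
        forall Pi' : probability (measurableTypeR R) R, stationary law Pi' ->
          forall A : set R, measurable A -> Pi' A = Pi A &
        forall x0 : R, 0 <= x0 <= 1 ->
          tv_dist (law x0 n) Pi @[n --> \oo] --> 0%E].

Definition density_on (R : realType) (F : probability (measurableTypeR R) R)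
    (f : R -> R) (J : set R) : Prop :=
  [/\ measurable_fun J f,
      forall x, J x -> 0 <= f x &
      forall A : set R, measurable A -> A `<=` J ->
        F A = (\int[lebesgue_measure]_(x in A) (f x)%:E)%E].

(* No measurability is claimed: for a nonnegative function, as this one is on
   ]s, t[ with densities as in [density_on], the library integral is the
   supremum of the integrals of the simple functions below it. *)
Definition overlap_density (R : realType) (delta : R) (fL fR : R -> R)
    (z : R) : R :=
  Num.min (inf [set fL ((y - z) / y) | y in `[1 - delta, 1]])
          (inf [set fR ((z - y) / (1 - y)) | y in `[0, delta]]).

(* Main.v *)
From HB Require Import structures.
From mathcomp Require Import ring lra.
Require Import Defs.
From mathcomp Require Import measurable_realfun giry.
Import Order.TTheory GRing.Theory Num.Theory.
Import numFieldNormedType.Exports.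
Local Open Scope classical_set_scope.
Local Open Scope ring_scope.
Set Implicit Arguments.
Unset Strict Implicit.
Unset Printing Implicit Defensive.

(** Ergodicity comes from Doeblin's criterion: two steps of the chain dominate
    one fixed nonzero measure [nu], whatever the starting point.

    To see this, call the points of [0, delta] and of [1 - delta, 1] the edges.
    From any [x], one of the two directions is chosen with probability at
    least 1/2, and the jump in that direction is longer than a fraction
    [1 - delta] of the available room with a probability bounded below by
    [cond2]; such a jump ends on an edge ([chain_kernel_to_edges]). From a
    point [y] of an edge, [cond1] bounds below the probability of moving
    towards the middle, and the landing point of that move is an affine image
    of a variable whose density near the middle is known: by the very
    definition of [overlap_density], the landing density at [z] is at least
    [overlap_density z], because the slope of the affine map is at most 1 in
    absolute value. [cond3] makes this lower bound nontrivial, and since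
    the integral of [overlap_density] is a supremum over simple functions,
    there are a constant [c > 0] and a measurable set [G] of positive Lebesgue
    measure on which [overlap_density >= c] ([level_set_of_integral_gt0]). Hence
    [nu] can be taken to be a multiple of Lebesgue measure restricted to [G]
    ([chain_kernel_minorization]).

    Doeblin's theorem ([doeblin]) is proved for an arbitrary measurable space.
    If two steps dominate [nu], then applying the transition operator twice
    shrinks the range of any bounded function by the factor [1 - nu setT]
    ([two_step_contraction]). So the laws of two chains at times at least [2 * j]
    differ, on every event, by at most the [j]-th power of that factor. The laws
    at time [n] are therefore uniformly Cauchy; their limit is a probability
    because the convergence is uniform over events, it is stationary by a Fatou
    inequality applied to an event and to its complement, and the same bound
    gives both uniqueness and convergence in total variation.

    What links the two is that the laws of the chain really evolve by its
    transition kernel ([recursion_law]): the state at time [n] depends only on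
    the variables used before time [n], so it is independent of those used
    later, and the step from [n] to [n + 1] has the product of the law of the
    state and of the law of the noise as its input. The kernel is defined on
    the whole line by first clamping the state to [0, 1], which makes the
    minorization uniform over all states; the laws of the chain are
    concentrated on [0, 1], so the clamping does not affect them. *)

(** * Doeblin's theorem *)

Section contraction.
Context d (X : measurableType d) (R : realType).
Local Open Scope ereal_scope.

(** The functions [f - a] and [b - f] are nonnegative, so their integrals grow
    with the measure. Both bounds have the same term [i], which does not depend
    on [mu]: this is what makes two such measures comparable. *)
Lemma integral_bounds (mu nu : {finite_measure set X -> \bar R})
    (f : X -> \bar R) (a b : R) : (0 <= a)%R ->
  mu setT = 1 ->
  (forall A, measurable A -> nu A <= mu A) ->
  measurable_fun setT f -> (forall x, a%:E <= f x <= b%:E) ->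
  let e := fine (nu setT) in
  exists2 i : R, \int[nu]_x f x = i%:E &
    (i + a * (1 - e))%:E <= \int[mu]_x f x <= (i + b * (1 - e))%:E.
Proof.
move=> a0 muT numu mf fab e.
have eE : nu setT = e%:E by rewrite fineK// fin_num_measure.
have f0 x : 0 <= f x.
  by have /andP[+ _] := fab x; apply: le_trans; rewrite lee_fin.
have ffin x : f x \is a fin_num.
  have /andP[ax xb] := fab x.
  by rewrite ge0_fin_numE//; exact: le_lt_trans xb (ltry _).
have b0 : (0 <= b)%R.
  have /andP[/le_trans + +] := fab point => /[apply].
  by rewrite lee_fin; exact: le_trans.
have intE (m : {finite_measure set X -> \bar R}) : \int[m]_x f x <= b%:E * m setT.
  rewrite -integral_cst//; apply: ge0_le_integral => //.
  by move=> x _; have /andP[] := fab x.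
have ifin (m : {finite_measure set X -> \bar R}) : \int[m]_x f x \is a fin_num.
  rewrite ge0_fin_numE; last exact: integral_ge0.
  apply: le_lt_trans (intE m) _.
  by rewrite -(fineK (fin_num_measure m _ measurableT))// -EFinM ltry.
have mfa : measurable_fun setT (fun x => f x - a%:E) by exact: emeasurable_funB.
have mfb : measurable_fun setT (fun x => b%:E - f x) by exact: emeasurable_funB.
have fa0 x : 0 <= f x - a%:E.
  by rewrite sube_ge0 ?ffin ?orbT//; have /andP[] := fab x.
have fb0 x : 0 <= b%:E - f x.
  by rewrite sube_ge0 ?ffin ?orbT//; have /andP[] := fab x.
have lowE (m : {finite_measure set X -> \bar R}) :
    \int[m]_x f x = \int[m]_x (f x - a%:E) + a%:E * m setT.
  rewrite -integral_cst// -ge0_integralD//.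
  by apply: eq_integral => x _; rewrite subeK.
have upE (m : {finite_measure set X -> \bar R}) :
    \int[m]_x (b%:E - f x) + \int[m]_x f x = b%:E * m setT.
  rewrite -integral_cst// -ge0_integralD//.
  by apply: eq_integral => x _; rewrite subeK.
have lowle := ge0_le_measure_integral numu measurableT fa0 mfa.
have uple := ge0_le_measure_integral numu measurableT fb0 mfb.
move: lowle uple (lowE mu) (lowE nu) (upE mu) (upE nu).
rewrite muT !mule1 eE -!EFinM.
have := ifin mu; have := ifin nu.
set i := \int[nu]_x f x; set j := \int[mu]_x f x.
set p := \int[nu]_x (f x - _); set q := \int[mu]_x (f x - _).
set p' := \int[nu]_x (_ - f x); set q' := \int[mu]_x (_ - f x).
case: i j => [i| |]// [j| |]// _ _.
case: p => [p| |]//; case: q => [q| |]//.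
case: p' => [p'| |]//; case: q' => [q'| |]//.
rewrite !lee_fin => pq pq' [jE] [iE] [jE'] [iE'].
by exists i => //; rewrite !lee_fin; apply/andP; split; nra.
Qed.

End contraction.

Section evolution.
Context d (X : measurableType d) (R : realType).
Variables (k : X -> giry X R) (mk : measurable_fun [set: X] k).
Local Open Scope ereal_scope.

Lemma giry_bindE (mu : giry X R) A : measurable A ->
  giry_bind mu mk A = \int[mu]_x k x A.
Proof.
move=> mA; rewrite -[LHS]/(giry_int _ _) giry_int_map//.
exact: measurable_giry_ev.
Qed.

(** Agreement is asked on measurable sets, so that a sequence of laws qualifies
    however it was built: the orbit of a point mass, a constant sequence at a
    stationary law, or the laws of random variables. *)
Definition evolution (mu : nat -> giry X R) : Prop :=
  forall n A, measurable A -> mu n.+1 A = giry_bind (mu n) mk A.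

Definition transition_op (f : X -> \bar R) (x : X) : \bar R := giry_int (k x) f.

Lemma transition_op_ge0 f : (forall x, 0 <= f x) ->
  forall x, 0 <= transition_op f x.
Proof. by move=> f0 x; exact: integral_ge0. Qed.

Lemma measurable_transition_op f : measurable_fun [set: X] f ->
  (forall x, 0 <= f x) -> measurable_fun [set: X] (transition_op f).
Proof.
move=> mf f0.
apply: (measurableT_comp (f := (giry_int (T := X) ^~ f)) (g := k)) => //.
exact: measurable_giry_int.
Qed.

Lemma iter_transition_op f m : measurable_fun [set: X] f -> (forall x, 0 <= f x) ->
  measurable_fun [set: X] (iter m transition_op f) /\
  forall x, 0 <= iter m transition_op f x.
Proof.
move=> mf f0; elim: m => // m [mPf Pf0]; rewrite iterS; split.
- exact: measurable_transition_op.
- exact: transition_op_ge0.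
Qed.

(** Duality: steps of the law can be traded for steps of the integrand. *)
Lemma evolution_integral mu f n m : evolution mu -> measurable_fun [set: X] f ->
  (forall x, 0 <= f x) ->
  \int[mu (n + m)%N]_x f x = \int[mu n]_x iter m transition_op f x.
Proof.
move=> emu; elim: m f => [|m IHm] f mf f0; first by rewrite addn0.
rewrite iterSr -IHm; last 2 first.
- exact: measurable_transition_op.
- exact: transition_op_ge0.
rewrite addnS -[RHS](giry_int_bind _ mk)//.
by apply: eq_measure_integral => A mA _; exact: emu.
Qed.

Lemma evolution_setT mu n : (forall x, k x setT = 1) -> evolution mu ->
  mu 0%N setT = 1 -> mu n setT = 1.
Proof.
move=> k1 emu mu1; elim: n => // n IHn.
rewrite emu// giry_bindE// -[RHS]IHn -[RHS]mul1e -integral_cst//.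
by apply: eq_integral => x _ /=; rewrite k1.
Qed.

Variable nu : {finite_measure set X -> \bar R}.
Hypothesis k1 : forall x, k x setT = 1.
Hypothesis minor : forall x A, measurable A -> nu A <= giry_bind (k x) mk A.
Let e := fine (nu setT).

(** The two-step laws from all the points [x] have the part [nu] in common.
    Against that part [f] has one and the same integral; only the remaining
    mass [1 - e] sees the values of [f] differ, by at most [b - a]. *)
Lemma two_step_contraction f (a b : R) : (0 <= a)%R -> measurable_fun [set: X] f ->
  (forall x, a%:E <= f x <= b%:E) ->
  exists a' b' : R, [/\ (0 <= a')%R, (b' - a' = (1 - e) * (b - a))%R &
    forall x, a'%:E <= iter 2 transition_op f x <= b'%:E].
Proof.
move=> a0 mf fab.
have f0 x : 0 <= f x.
  by have /andP[+ _] := fab x; apply: le_trans; rewrite lee_fin.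
have bindT x : giry_bind (k x) mk setT = 1.
  rewrite giry_bindE// -[RHS](k1 x) -[RHS]mul1e -integral_cst//.
  by apply: eq_integral => y _ /=; rewrite k1.
have e1 : (e <= 1)%R.
  by rewrite -lee_fin fineK ?fin_num_measure// -(bindT point) minor.
have sandwich x := integral_bounds a0 (bindT x) (@minor x) mf fab.
have [i iE _] := sandwich point.
exists (i + a * (1 - e))%R, (i + b * (1 - e))%R; split.
- rewrite addr_ge0//; last by rewrite mulr_ge0// subr_ge0.
  by rewrite -lee_fin -iE; exact: integral_ge0.
- by ring.
- move=> x; have [j jE] := sandwich x.
  move: jE; rewrite iE => -[<-].
  by rewrite -[X in _ <= X <= _ -> _]/(giry_int _ _) giry_int_bind.
Qed.

Lemma iter_contraction f j : measurable_fun [set: X] f ->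
  (forall x, 0 <= f x <= 1) ->
  exists a b : R, [/\ (0 <= a)%R, (b - a = (1 - e) ^+ j)%R &
    forall x, a%:E <= iter j.*2 transition_op f x <= b%:E].
Proof.
move=> mf f01.
have f0 x : 0 <= f x by have /andP[] := f01 x.
elim: j => [|j [a [b [a0 ba Pab]]]]; first by exists 0%R, 1%R; split; rewrite ?subr0.
have [mPf _] := iter_transition_op j.*2 mf f0.
have [a' [b' [a'0 ba' Pab']]] := two_step_contraction a0 mPf Pab.
by exists a', b'; split => //; rewrite ba' ba exprS.
Qed.

(** The last [2 * j] steps alone place both probabilities in the range of
    [iter j.*2 transition_op \1_A], whatever happened before; the times and the
    initial laws need not agree. *)
Lemma evolution_contraction mu1 mu2 A j n1 n2 :
  evolution mu1 -> evolution mu2 -> mu1 0%N setT = 1 -> mu2 0%N setT = 1 ->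
  measurable A -> (j.*2 <= n1)%N -> (j.*2 <= n2)%N ->
  `|mu1 n1 A - mu2 n2 A| <= ((1 - e) ^+ j)%:E.
Proof.
move=> emu1 emu2 mu11 mu21 mA jn1 jn2.
pose f x : \bar R := (\1_A x)%:E.
have mf : measurable_fun [set: X] f by exact/measurable_EFinP.
have f0 x : 0 <= f x by rewrite lee_fin.
have f01 x : 0 <= f x <= 1 by rewrite f0/= lee_fin indicE; case: (_ \in _).
have [a [b [a0 ba Pab]]] := iter_contraction j mf f01.
have ab_mu mu n : evolution mu -> mu 0%N setT = 1 -> (j.*2 <= n)%N ->
    a%:E <= mu n A <= b%:E.
  move=> emu muT jn.
  rewrite -(setIT A) -integral_indic// -(subnK jn) (evolution_integral _ _ emu)//.
  have muTn := evolution_setT (n - j.*2)%N k1 emu muT.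
  have [mPf Pf0] := iter_transition_op j.*2 mf f0.
  have int_cst (c : R) : c%:E = \int[mu (n - j.*2)%N]_x (cst c%:E) x.
    by rewrite integral_cst// -[LHS]mule1; congr (_ * _); exact/esym.
  rewrite (int_cst a) (int_cst b).
  apply/andP; split; apply: ge0_le_integral => //=.
  - by move=> x _; have /andP[] := Pab x.
  - by move=> x _; have /andP[] := Pab x.
have := ab_mu _ _ emu2 mu21 jn2; have := ab_mu _ _ emu1 mu11 jn1.
rewrite -[mu1 n1 A]fineK ?fin_num_measure// -[mu2 n2 A]fineK ?fin_num_measure//.
rewrite !lee_fin -ba => /andP[? ?] /andP[? ?].
by rewrite ler_norml; apply/andP; split; lra.
Qed.
End evolution.

(** A limit of probabilities is always finitely additive. Countable additivity
    uses the uniformity in [A]: a single [mu N] is close to [p] on all the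
    partial unions at once, and [mu N] is continuous along them. *)
Section uniform_limit.
Context d (X : measurableType d) (R : realType).
Variables (mu : nat -> subprobability X R) (p : set X -> R).
Hypothesis p0 : forall A, 0 <= p A.
Hypothesis muT : forall n, mu n setT = 1%E.
Hypothesis mup : forall eps, 0 < eps -> \forall n \near \oo,
  forall A, measurable A -> `|p A - fine (mu n A)| <= eps.

Let mup_cvg A : measurable A -> fine (mu n A) @[n --> \oo] --> p A.
Proof.
move=> mA; apply/cvgrPdist_le => eps eps0.
by near=> n; near: n; apply: filterS (mup eps0) => n; exact.
Unshelve. all: by end_near. Qed.

Let limit0 : (p set0)%:E = 0%E.
Proof.
have := mup_cvg measurable0; under eq_fun do rewrite measure0.
by move=> /(cvg_unique _ (cvg_cst (0 : R))) <-.
Qed.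

Let limitT : (p setT)%:E = 1%E.
Proof.
have := mup_cvg measurableT; under eq_fun do rewrite muT.
by move=> /(cvg_unique _ (cvg_cst (1 : R))) <-.
Qed.

Let limit_additive (F : nat -> set X) n :
  (forall i, measurable (F i)) -> trivIset setT F ->
  p (\big[setU/set0]_(i < n) F i) = \sum_(0 <= i < n) p (F i).
Proof.
move=> mF tF.
have mU : measurable (\big[setU/set0]_(i < n) F i) by exact: bigsetU_measurable.
have cvgS : \sum_(0 <= i < n) fine (mu m (F i)) @[m --> \oo] -->
    \sum_(0 <= i < n) p (F i).
  by apply: cvg_big => [|i _]; [exact: add_continuous|exact: mup_cvg].
have := mup_cvg mU; rewrite (_ : (fun _ => fine _) =
    (fun m => \sum_(0 <= i < n) fine (mu m (F i)))).
  by move=> cvgU; exact: cvg_unique cvgU cvgS.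
apply/funext => m; rewrite measure_semi_additive//.
by rewrite big_mkord sum_fine// => i _; rewrite fin_num_measure.
Qed.

Let limit_sigma_additive : semi_sigma_additive (EFin \o p).
Proof.
move=> F mF tF mU.
rewrite [X in X @ _ --> _](_ : _ =
  EFin \o (fun n => p (\big[setU/set0]_(i < n) F i))); last first.
  by apply/funext => n /=; rewrite limit_additive// sumEFin.
apply/fine_cvgP; split; first by near=> n.
apply/cvgrPdist_le => eps eps0 /=.
have eps3 : 0 < eps / 3 by rewrite divr_gt0.
have [N _ /(_ N (leqnn N)) muN] := mup eps3.
have cvgN : fine (mu N (\big[setU/set0]_(i < n) F i)) @[n --> \oo] -->
    fine (mu N (\bigcup_i F i)).
  apply: fine_cvg; rewrite fineK ?fin_num_measure//.
  rewrite [X in X @ _ --> _](_ : _ = (fun n => (\sum_(0 <= i < n) mu N (F i))%E)).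
    exact: measure_semi_sigma_additive.
  apply/funext => n; rewrite measure_semi_additive// ?big_mkord//.
  exact: bigsetU_measurable.
move/cvgrPdist_le : cvgN => /(_ _ eps3) cvgN.
near=> n.
have mV : measurable (\big[setU/set0]_(i < n) F i) by exact: bigsetU_measurable.
have h1 := muN _ mU; have h2 := muN _ mV.
have h3 : `|fine (mu N (\bigcup_i F i)) -
            fine (mu N (\big[setU/set0]_(i < n) F i))| <= eps / 3 by near: n.
move: h1 h2 h3; rewrite !ler_norml => /andP[? ?] /andP[? ?] /andP[? ?].
by apply/andP; split; lra.
Unshelve. all: by end_near. Qed.

Let limit : set X -> \bar R := EFin \o p.

Let limit_ge0 A : (0 <= limit A)%E. Proof. by rewrite lee_fin. Qed.

HB.instance Definition _ := isMeasure.Build _ _ _ limit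
  limit0 limit_ge0 limit_sigma_additive.

HB.instance Definition _ := Measure_isProbability.Build _ _ _ limit limitT.

Lemma uniform_limit_probability :
  exists Pi : probability X R, forall A, Pi A = (p A)%:E.
Proof. by exists limit. Qed.

End uniform_limit.

Section setwise_fatou.
Context d (X : measurableType d) (R : realType).
Variables (mu_ : nat -> {measure set X -> \bar R}) (mu : {measure set X -> \bar R}).
Hypothesis mu_cvg : forall A, measurable A -> mu_ n A @[n --> \oo] --> mu A.
Local Open Scope ereal_scope.
Import HBNNSimple.

(** Fatou's inequality for setwise convergence of measures: the integral of a
    simple function is a finite combination of measures of sets, hence
    converges, and the integral of [f] is a supremum of such integrals. *)
Lemma setwise_integral_le f (c_ : nat -> \bar R) c : (forall x, 0 <= f x) ->
  (forall n, \int[mu_ n]_x f x <= c_ n) -> c_ n @[n --> \oo] --> c ->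
  \int[mu]_x f x <= c.
Proof.
move=> f0 fc cc; rewrite ge0_integralE//= patch_setT.
apply: ub_ereal_sup => _ [h/= hf] <-.
have finh : finite_set (range h) by [].
have hc n : sintegral (mu_ n) h <= c_ n.
  apply: le_trans (fc n); rewrite ge0_integralE//= patch_setT.
  by apply: ereal_sup_ubound; exists h.
have cvgh : sintegral (mu_ n) h @[n --> \oo] --> sintegral mu h.
  under eq_fun do rewrite sintegralE fsbig_finite//.
  rewrite sintegralE fsbig_finite//=; apply: cvg_nnesum => x _.
    by near=> n; rewrite nnsfun_mulemu_ge0.
  apply: cvgeZl => //; exact: mu_cvg.
rewrite -(cvg_lim _ cvgh)// -(cvg_lim _ cc)//; apply: lee_lim.
- by apply/cvg_ex; eexists; exact: cvgh.
- by apply/cvg_ex; eexists; exact: cc.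
- by near=> n; exact: hc.
Unshelve. all: by end_near. Qed.

End setwise_fatou.

Section doeblin.
Context d (X : measurableType d) (R : realType).
Variables (k : X -> giry X R) (mk : measurable_fun [set: X] k).
Hypothesis k1 : forall x, k x setT = 1%E.
Variable nu : {finite_measure set X -> \bar R}.
Hypothesis nu_gt0 : (0 < nu setT)%E.
Hypothesis minor : forall x A, measurable A -> (nu A <= giry_bind (k x) mk A)%E.
Let e := fine (nu setT).

Let mu n : giry X R := iter n (fun m => giry_bind m mk) (giry_ret point).

Let emu : evolution mk mu. Proof. by []. Qed.

Let muT : mu 0%N setT = 1%E. Proof. exact: diracT. Qed.

Let e01 : 0 < e <= 1.
Proof.
have eE : e%:E = nu setT by rewrite fineK// fin_num_measure.
rewrite -lte_fin -lee_fin eE nu_gt0/=; apply: le_trans (minor point measurableT) _.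
exact: sprobability_setT.
Qed.

Let rate_cvg0 : (1 - e) ^+ n @[n --> \oo] --> 0.
Proof. by apply: cvg_expr; have /andP[? ?] := e01; rewrite ger0_norm; lra. Qed.

Let rate_small eps : 0 < eps -> exists j, (1 - e) ^+ j <= eps.
Proof.
move=> eps0; move/cvgrPdist_le : rate_cvg0 => /(_ _ eps0)[j _ /(_ j (leqnn j))] /= h.
by exists j; apply: le_trans h; rewrite sub0r normrN ler_norm.
Qed.

Let mu_dist (mu' : nat -> giry X R) A j n1 n2 : evolution mk mu' ->
  mu' 0%N setT = 1%E -> measurable A -> (j.*2 <= n1)%N -> (j.*2 <= n2)%N ->
  `|fine (mu n1 A) - fine (mu' n2 A)| <= (1 - e) ^+ j.
Proof.
move=> emu' muT' mA h1 h2.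
have := evolution_contraction k1 minor emu emu' muT muT' mA h1 h2.
by rewrite -[mu n1 A]fineK ?fin_num_measure// -[mu' n2 A]fineK ?fin_num_measure.
Qed.

(* The value 0 off the measurable sets keeps [p] nonnegative on every set, as
   the interface of measures requires. *)
Let p A := if `[< measurable A >] then limn (fun n => fine (mu n A)) else 0.

Let pE A : measurable A -> p A = limn (fun n => fine (mu n A)).
Proof. by move=> mA; rewrite /p asboolT. Qed.

Let mu_is_cvg A : measurable A -> cvgn (fun n => fine (mu n A)).
Proof.
move=> mA; apply/cauchy_cvgP/cauchy_exP => eps eps0.
have eps2 : 0 < eps / 2 by rewrite divr_gt0.
have [j jeps] := rate_small eps2.
exists (fine (mu j.*2 A)), j.*2 => // n /= jn; rewrite /ball/=.
apply: le_lt_trans (mu_dist emu muT mA (leqnn _) jn) _.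
by apply: le_lt_trans jeps _; lra.
Qed.

Let mu_p (mu' : nat -> giry X R) A j n : evolution mk mu' ->
  mu' 0%N setT = 1%E -> measurable A -> (j.*2 <= n)%N ->
  `|p A - fine (mu' n A)| <= (1 - e) ^+ j.
Proof.
move=> emu' muT' mA jn; rewrite pE//.
have cvgd : `|fine (mu m A) - fine (mu' n A)| @[m --> \oo] -->
    `|limn (fun n => fine (mu n A)) - fine (mu' n A)|.
  by apply: cvg_norm; apply: cvgB; [exact: mu_is_cvg|exact: cvg_cst].
rewrite -(cvg_lim _ cvgd)//; apply: limr_le.
  by apply/cvg_ex; eexists; exact: cvgd.
by exists j.*2 => // m /= jm; exact: mu_dist.
Qed.

Let p0 A : 0 <= p A.
Proof.
rewrite /p; case: asboolP => // mA; apply: limr_ge; first exact: mu_is_cvg.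
by apply: nearW => n; rewrite fine_ge0.
Qed.

(** The existence of the limit [Pi], its uniqueness and the geometric rate all
    come from comparing the orbit of a point mass with another evolution:
    respectively its own later terms, the constant evolution at a stationary
    law, and an arbitrary one. *)
Theorem doeblin : exists (Pi : probability X R) (r : R),
  [/\ 0 <= r < 1,
      forall A, measurable A -> (\int[Pi]_x k x A = Pi A)%E,
      forall Pi' : probability X R,
        (forall A, measurable A -> (\int[Pi']_x k x A = Pi' A)%E) ->
        forall A, measurable A -> Pi' A = Pi A
    & forall mu' : nat -> giry X R, evolution mk mu' -> mu' 0%N setT = 1%E ->
        forall j n A, measurable A -> (j.*2 <= n)%N ->
          (`|mu' n A - Pi A| <= (r ^+ j)%:E)%E].
Proof.
have muTn n : mu n setT = 1%E by exact: (evolution_setT n k1 emu muT).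
have unif eps : 0 < eps -> \forall n \near \oo, forall A, measurable A ->
    `|p A - fine (mu n A)| <= eps.
  move=> eps0; have [j jeps] := rate_small eps0.
  exists j.*2 => //= n jn A mA; apply: le_trans jeps.
  exact: (mu_p emu muT mA jn).
have [Pi PiE] := uniform_limit_probability p0 muTn unif.
have muPi A : measurable A -> mu n A @[n --> \oo] --> Pi A.
  move=> mA; rewrite PiE pE//.
  rewrite (_ : (fun n => mu n A) = (fun n => (fine (mu n A))%:E)).
    by apply: cvg_EFin; [near=> n|exact: mu_is_cvg].
  by apply/funext => n; rewrite fineK// fin_num_measure.
have stat_le A : measurable A -> (\int[Pi]_x k x A <= Pi A)%E.
  move=> mA; apply: (setwise_integral_le muPi (c_ := fun n => mu n.+1 A)) => //.
    by move=> n; rewrite emu// giry_bindE.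
  by have := muPi _ mA; rewrite -(cvg_shiftS (fun n => mu n A)).
(* The inequalities for [A] and for its complement add up to [1 <= 1], so both
   are equalities. *)
have stat A : measurable A -> (\int[Pi]_x k x A = Pi A)%E.
  move=> mA; apply/eqP; rewrite eq_le stat_le//=.
  have := stat_le _ (measurableC mA).
  have mkA B : measurable B -> measurable_fun [set: X] (fun x => k x B).
    move=> mB.
    by apply: (measurableT_comp (f := (giry_ev (T := X) ^~ B)) (g := k)) => //;
      exact: measurable_giry_ev.
  have kC : (\int[Pi]_x k x A + \int[Pi]_x k x (~` A) = 1)%E.
    rewrite -ge0_integralD//; [|exact: mkA|by apply: mkA; exact: measurableC].
    rewrite (eq_integral (cst 1%E)).
      by rewrite integral_cst// mul1e; exact: probability_setT.
    move=> x _; rewrite -measureU ?setICr//; last exact: measurableC.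
    by rewrite setUv; exact: k1.
  have [inA inC] : (\int[Pi]_x k x A \is a fin_num /\
      \int[Pi]_x k x (~` A) \is a fin_num)%E.
    by apply/andP; rewrite -fin_numD kC.
  rewrite probability_setC// -(fineK inA) -(fineK (fin_num_measure Pi _ mA)).
  move: kC; rewrite -(fineK inA) -(fineK inC) => -[kC].
  by rewrite !lee_fin; lra.
have close mu' : evolution mk mu' -> mu' 0%N setT = 1%E ->
    forall j n A, measurable A -> (j.*2 <= n)%N ->
    (`|mu' n A - Pi A| <= ((1 - e) ^+ j)%:E)%E.
  move=> emu' muT' j n A mA jn.
  rewrite PiE -[mu' n A]fineK ?fin_num_measure// lee_fin distrC.
  exact: mu_p.
exists Pi, (1 - e); split => //.
  by have /andP[? ?] := e01; apply/andP; split; lra.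
move=> Pi' statPi' A mA.
have ePi' : evolution mk (fun=> Pi' : giry X R).
  by move=> n B mB; rewrite giry_bindE// statPi'.
have closeA j : `|fine (Pi' A) - p A| <= (1 - e) ^+ j.
  have := close _ ePi' (probability_setT Pi') j _ A mA (leqnn _).
  by rewrite PiE /= -[Pi' A]fineK ?fin_num_measure.
rewrite PiE -[Pi' A]fineK ?fin_num_measure//; congr EFin; apply/eqP.
rewrite -subr_eq0 -normr_le0; apply/ler_addgt0Pr => eps eps0.
have [j jeps] := rate_small eps0.
by rewrite add0r; exact: le_trans (closeA j) jeps.
Unshelve. all: by end_near. Qed.
End doeblin.

(** * Recursions driven by independent noise *)

Section product_law.
Context d d1 d2 (T : measurableType d) (S1 : measurableType d1)
  (S2 : measurableType d2) (R : realType).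
Local Open Scope ereal_scope.

(** Divided by [P E], the hypothesis gives the law of [(Y, Z)] conditionally on
    [E] for rectangles, and a product measure is determined by its values
    there. An [E] of probability 0 makes both sides vanish. *)
Lemma product_law_on_event (P : probability T R) (E : set T) (Y : T -> S1)
    (Z : T -> S2) (m1 : subprobability S1 R) (m2 : subprobability S2 R) :
  measurable E -> measurable_fun setT Y -> measurable_fun setT Z ->
  (forall B C, measurable B -> measurable C ->
     P (E `&` (Y @^-1` B `&` Z @^-1` C)) = P E * (m1 B * m2 C)) ->
  forall D, measurable D ->
    P (E `&` (fun w => (Y w, Z w)) @^-1` D) = P E * (m1 \x m2) D.
Proof.
move=> mE mY mZ rect D mD.
have mYZ : measurable_fun setT (fun w => (Y w, Z w)) by exact: measurable_fun_pair.
have mYZD : measurable ((fun w => (Y w, Z w)) @^-1` D).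
  by rewrite -[X in measurable X]setTI; exact: mYZ.
have [PE0|PE_neq0] := eqVneq (P E) 0.
  rewrite PE0 mul0e; apply: (subset_measure0 _ _ _ PE0) => //.
  exact: measurableI.
have PEfin : P E \is a fin_num by rewrite fin_num_measure.
have r0 : (0 <= (fine (P E))^-1)%R by rewrite invr_ge0 fine_ge0.
pose f w := (Y w, Z w).
have [push pushE] : exists m : {measure set (S1 * S2) -> \bar R},
    forall A, m A = P (E `&` f @^-1` A).
  unshelve eexists.
  - refine (pushforward (mrestr P mE) f : {measure set (S1 * S2) -> \bar R}).
    exact: mYZ.
  - by move=> A; rewrite /= /pushforward /mrestr setIC.
pose m' := mscale (NngNum r0) push.
have m'E A : m' A = (fine (P E))^-1%:E * P (E `&` f @^-1` A).
  by rewrite /m' /mscale/= pushE.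
have PEK x : P E * ((fine (P E))^-1%:E * x) = x.
  by rewrite muleA -{1}(fineK PEfin) -EFinM divff ?mul1e// fine_eq0.
have m'X B C : measurable B -> measurable C -> m' (B `*` C) = m1 B * m2 C.
  move=> mB mC.
  rewrite m'E -[X in E `&` X]/(Y @^-1` B `&` Z @^-1` C) rect//.
  by rewrite muleCA PEK.
by rewrite (product_measure_unique m'X)// -[X in _ * X]/(m' D) m'E PEK.
Qed.

End product_law.

Section cylinder.
Context d (T : measurableType d) (R : realType) (P : probability T R).
Variables (I : choiceType) (W : I -> {RV P >-> R}).
Hypothesis indW : mutually_independent W.
Local Open Scope ereal_scope.

Definition cylinder (J : {fset I}) (B : I -> set R) : set T :=
  \bigcap_(i in [set` J]) W i @^-1` B i.

Lemma measurable_cylinder J B : (forall i, measurable (B i)) ->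
  measurable (cylinder J B).
Proof.
move=> mB; apply: fin_bigcap_measurable => // i _.
by rewrite -[X in measurable X]setTI; exact: measurable_funP.
Qed.

(** Adding one constraint to a cylinder gives another cylinder, so mutual
    independence, which speaks of cylinders only, splits off one factor. *)
Lemma cylinder_cons J B i C : (forall j, measurable (B j)) -> measurable C ->
  i \notin J ->
  let B' j := if j == i then C else B j in
  cylinder (i |` J)%fset B' = W i @^-1` C `&` cylinder J B /\
  P (W i @^-1` C `&` cylinder J B) = P (W i @^-1` C) * P (cylinder J B).
Proof.
move=> mB mC iJ B'.
have mB' j : measurable (B' j) by rewrite /B'; case: ifP.
have neq j : j \in J -> (j == i) = false.
  by move=> jJ; apply: contraNF iJ => /eqP <-.
have E : cylinder (i |` J)%fset B' = W i @^-1` C `&` cylinder J B.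
  rewrite /cylinder set_fsetU1 bigcap_setU1 /B' eqxx; congr (_ `&` _).
  by apply: eq_bigcapr => j /= /neq ->.
split => //; rewrite -E /cylinder indW// indW//.
rewrite big_fsetU1//= /B' eqxx; congr (_ * _).
by rewrite !big_seq; apply: eq_bigr => j /neq ->.
Qed.

End cylinder.

Section driven_recursion.
Context d (T : measurableType d) (R : realType) (P : probability T R).
Variables (Ls Rs Us : nat -> {RV P >-> R}).
Notation W := (gather3 Ls Rs Us).
Hypothesis indW : mutually_independent W.
Hypothesis idL : forall n, has_law (Ls n) (distribution P (Ls 0%N)).
Hypothesis idR : forall n, has_law (Rs n) (distribution P (Rs 0%N)).
Hypothesis idU : forall n, has_law (Us n) (distribution P (Us 0%N)).
Local Open Scope ereal_scope.

Definition noise_law : giry (R * (R * R))%type R :=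
  giry_prod (distribution P (Ls 0%N) : giry R R,
    giry_prod (distribution P (Rs 0%N) : giry R R,
               distribution P (Us 0%N) : giry R R)).

Definition noise n w : R * (R * R) := (Ls n w, (Rs n w, Us n w)).

Lemma measurable_noise n : measurable_fun setT (noise n).
Proof. by apply: measurable_fun_pair => //; exact: measurable_fun_pair. Qed.

Definition stage (i : nat + nat + nat) : nat :=
  match i with inl (inl n) => n | inl (inr n) => n | inr n => n end.

Definition future n (E : set T) : Prop := exists J B,
  [/\ forall i, measurable (B i), forall i, i \in J -> (n <= stage i)%N &
      E = cylinder W J B].

Lemma measurable_future n E : future n E -> measurable E.
Proof. by move=> [J [B [mB _ ->]]]; exact: measurable_cylinder. Qed.

Lemma future_setT n : future n setT.
Proof.
exists fset0, (fun=> setT); split => //; apply/esym.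
by rewrite /cylinder set_fset0 bigcap_set0.
Qed.

(** The three variables of stage [n] have indices outside a cylinder of later
    stages, so they can be split off one after the other. *)
Lemma future_noise n E B1 B2 B3 : future n.+1 E ->
  measurable B1 -> measurable B2 -> measurable B3 ->
  let E' := Ls n @^-1` B1 `&` (Rs n @^-1` B2 `&` (Us n @^-1` B3 `&` E)) in
  future n E' /\
  P E' = distribution P (Ls 0%N) B1 *
    (distribution P (Rs 0%N) B2 * (distribution P (Us 0%N) B3 * P E)).
Proof.
move=> [J [B [mB JB ->]]] mB1 mB2 mB3 E'.
have notinJ i : stage i = n -> i \notin J.
  by move=> in_; apply/negP => /JB; rewrite in_ ltnn.
have [U1 U2] := cylinder_cons indW mB mB3 (notinJ (inr n) erefl).
set BU := fun j => _ in U1; set JU := (_ |` J)%fset in U1.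
have mBU j : measurable (BU j) by rewrite /BU; case: ifP.
have RJ : inl (inr n) \notin JU by rewrite /JU !inE/= notinJ.
have [R1 R2] := cylinder_cons indW mBU mB2 RJ.
set BR := fun j => _ in R1; set JR := (_ |` JU)%fset in R1.
have mBR j : measurable (BR j) by rewrite /BR; case: ifP.
have LJ : inl (inl n) \notin JR by rewrite /JR /JU !inE/= notinJ.
have [L1 L2] := cylinder_cons indW mBR mB1 LJ.
set BL := fun j => _ in L1; set JL := (_ |` JR)%fset in L1.
have E'E : E' = cylinder W JL BL by rewrite L1 R1 U1.
split.
  exists JL, BL; split => //.
    by move=> j; rewrite /BL; case: ifP.
  move=> j; rewrite /JL /JR /JU !inE.
  by move=> /or4P[/eqP->|/eqP->|/eqP->|/JB/ltnW]//=.
rewrite E'E L1 L2 R1 R2 U1 U2.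
by congr (_ * (_ * (_ * _))); [exact: idL|exact: idR|exact: idU].
Qed.

Context d' (S : measurableType d').
Variables (phi : S * (R * (R * R)) -> S) (X : nat -> T -> S) (x0 : S).
Hypothesis mphi : measurable_fun setT phi.
Hypothesis X0 : forall w, X 0%N w = x0.
Hypothesis XS : forall n w, X n.+1 w = phi (X n w, noise n w).

Lemma measurable_recursion n : measurable_fun setT (X n).
Proof.
elim: n => [|n IHn].
  by rewrite (_ : X 0%N = cst x0)//; apply/funext => w; rewrite X0.
rewrite (_ : X n.+1 = phi \o (fun w => (X n w, noise n w))).
  apply: measurableT_comp => //; apply: measurable_fun_pair => //.
  exact: measurable_noise.
by apply/funext => w; rewrite XS.
Qed.

Let law n : giry S R := giry_map (measurable_recursion n) (P : giry T R).

Let mpre d1 (T1 : measurableType d1) (f : T -> T1) A :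
  measurable_fun setT f -> measurable A -> measurable (f @^-1` A).
Proof. by move=> mf mA; rewrite -[X in measurable X]setTI; exact: mf. Qed.

Definition independent_of_future n := forall E C, future n E -> measurable C ->
  P (E `&` X n @^-1` C) = P E * law n C.

(** The pairs [(Rs n, Us n)], [(Ls n, (Rs n, Us n))] and [(X n, noise n)] are
    treated in this order by [product_law_on_event]; at each stage the
    constraints on the other variables are put into the event. *)
Lemma joint_law n E D : independent_of_future n -> future n.+1 E ->
  measurable D ->
  P (E `&` (fun w => (X n w, noise n w)) @^-1` D) =
  P E * (law n \x noise_law) D.
Proof.
move=> indep fE mD; have mE := measurable_future fE.
have mX := measurable_recursion n.
have mRU : measurable_fun setT (fun w => (Rs n w, Us n w)).
  exact: measurable_fun_pair.
have rect C B1 B2 B3 :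
    measurable C -> measurable B1 -> measurable B2 -> measurable B3 ->
    P (E `&` X n @^-1` C `&` Ls n @^-1` B1 `&`
       (Rs n @^-1` B2 `&` Us n @^-1` B3)) =
    P E * law n C * distribution P (Ls 0%N) B1 *
      (distribution P (Rs 0%N) B2 * distribution P (Us 0%N) B3).
  move=> mC mB1 mB2 mB3; have [fE' PE'] := future_noise fE mB1 mB2 mB3.
  have := indep _ _ fE' mC; rewrite PE'.
  rewrite [X in P X = _ -> _](_ : _ = E `&` X n @^-1` C `&` Ls n @^-1` B1 `&`
       (Rs n @^-1` B2 `&` Us n @^-1` B3)); last first.
    by apply/seteqP; split => w /=; tauto.
  move=> ->; rewrite -!muleA.
  generalize (distribution P (Ls 0%N) B1) (distribution P (Rs 0%N) B2)
    (distribution P (Us 0%N) B3) (P E) (law n C) => a b c e l.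
  by rewrite (muleCA c) (muleCA b) (muleCA a) (muleC c) (muleCA b) (muleCA a)
    (muleC l) -!muleA (muleC c).
have fT : distribution P (Rs 0%N) setT = 1 by exact: probability_setT.
have gT : distribution P (Us 0%N) setT = 1 by exact: probability_setT.
have rect1 C B1 : measurable C -> measurable B1 ->
    P (E `&` X n @^-1` C `&` Ls n @^-1` B1) =
    P E * law n C * distribution P (Ls 0%N) B1.
  move=> mC mB1; have := rect C B1 _ _ mC mB1 measurableT measurableT.
  by rewrite !preimage_setT !setIT fT gT !mule1.
have rect2 C : measurable C -> P (E `&` X n @^-1` C) = P E * law n C.
  move=> mC; have := rect1 C _ mC measurableT.
  rewrite !preimage_setT !setIT => ->; rewrite -[RHS]mule1; congr (_ * _).
  exact: probability_setT.
apply: product_law_on_event => //; first exact: measurable_noise.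
move=> C D' mC mD'; rewrite setIA muleA -rect2//.
apply: (product_law_on_event (Y := Ls n) (Z := fun w => (Rs n w, Us n w))) => //.
  by apply: measurableI => //; exact: mpre.
move=> B1 D2 mB1 mD2; rewrite setIA muleA rect2// -rect1//.
apply: product_law_on_event => //.
  by apply: measurableI => //; [apply: measurableI => //|]; exact: mpre.
by move=> B2 B3 mB2 mB3; rewrite rect// rect1.
Qed.

(** Induction on [n]: the next state is a function of [X n] and [noise n], whose
    joint law is the same on every event of the later future. *)
Lemma recursion_independent n : independent_of_future n.
Proof.
elim: n => [|n IHn] E C fE mC.
  rewrite /law/= /giry_map/= /pushforward.
  have [x0C|x0C] := pselect (C x0).
    rewrite (_ : X 0%N @^-1` C = setT); last first.
      by apply/seteqP; split => // w _; rewrite /preimage/= X0.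
    by rewrite setIT probability_setT mule1.
  rewrite (_ : X 0%N @^-1` C = set0); last first.
    by apply/seteqP; split => // w; rewrite /preimage/= X0.
  by rewrite setI0 !measure0 mule0.
have mphiC : measurable (phi @^-1` C).
  by rewrite -[X in measurable X]setTI; exact: mphi.
have XE : X n.+1 @^-1` C = (fun w => (X n w, noise n w)) @^-1` (phi @^-1` C).
  by apply/funext => w; rewrite /preimage/= XS.
rewrite {1}XE joint_law//; congr (_ * _).
have := joint_law IHn (future_setT n.+1) mphiC.
by rewrite setTI probability_setT mul1e -XE => <-.
Qed.

Lemma recursion_law n A : measurable A ->
  law n.+1 A = \int[law n]_x noise_law [set v | A (phi (x, v))].
Proof.
move=> mA; have mphiA : measurable (phi @^-1` A).
  by rewrite -[X in measurable X]setTI; exact: mphi.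
have XE : X n.+1 @^-1` A = (fun w => (X n w, noise n w)) @^-1` (phi @^-1` A).
  by apply/funext => w; rewrite /preimage/= XS.
have := joint_law (@recursion_independent n) (future_setT n.+1) mphiA.
rewrite setTI probability_setT mul1e -XE => PX.
rewrite -[LHS]/(P (X n.+1 @^-1` A)) PX.
apply: eq_integral => x _ /=; congr (noise_law _).
by apply/seteqP; split => v; rewrite /xsection/= inE.
Qed.

End driven_recursion.

(** * Lower bounds for affine images of a density *)

Section affine_change.
Context (R : realType).
Notation lambda := (@lebesgue_measure R).
Local Open Scope ereal_scope.

Lemma measurable_affine (a b : R) :
  measurable_fun (setT : set (measurableTypeR R))
    ((fun r => b + a * r)%R : measurableTypeR R -> measurableTypeR R).
Proof.
have h : measurable_fun (setT : set R) (fun r : R => b + a * r)%R.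
  by apply: measurable_funD => //; exact: measurable_funM.
exact: h.
Qed.

(** The right-hand side is a measure in [A] with the right value on intervals,
    which characterizes Lebesgue measure. *)
Lemma lebesgue_measure_affine (a b : R) (A : set R) : (a != 0)%R ->
  measurable (A : set (measurableTypeR R)) ->
  lambda A = `|a|%:E * lambda ((fun r => b + a * r)%R @^-1` A).
Proof.
move=> a0; pose f r : R := (b + a * r)%R.
have [push pushE] : exists m : {measure set (measurableTypeR R) -> \bar R},
    forall A, m A = lambda (f @^-1` A).
  unshelve eexists.
  - refine (pushforward lambda (f : measurableTypeR R -> measurableTypeR R)
      : {measure set (measurableTypeR R) -> \bar R}).
    exact: measurable_affine.
  - by [].
have r0 : (0 <= `|a|)%R by [].
move=> mA; rewrite -pushE -[RHS]/(mscale (NngNum r0) push A).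
apply: lebesgue_measure_unique A mA => _ [[x y] _ <-].
rewrite /mscale/= [X in _ = _ * X](pushE `]x, y]%classic).
have [xy|yx] := ltP x y; last first.
  rewrite set_itv_ge ?bnd_simp -?leNgt//= preimage_set0 !measure0 mule0//.
have [a_gt0|a_lt0|aE] := ltgtP 0%R a; last by rewrite -aE eqxx in a0.
- rewrite (_ : f @^-1` _ = `]((x - b) / a)%R, ((y - b) / a)%R]%classic); last first.
    apply/seteqP; split => r /=; rewrite /f !in_itv/= ltr_pdivrMr// ler_pdivlMr//;
      by move=> /andP[? ?]; apply/andP; split; lra.
  rewrite !lebesgue_measure_itv/= !lte_fin xy ltr_pM2r ?invr_gt0// ltrD2r xy.
  by rewrite gtr0_norm// -!EFinD -EFinM; congr EFin; field.
(* A negative slope exchanges the two ends, hence the half-open side. *)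
- rewrite (_ : f @^-1` _ = `[((y - b) / a)%R, ((x - b) / a)%R[%classic); last first.
    apply/seteqP; split => r /=; rewrite /f !in_itv/= ler_ndivrMr// ltr_ndivlMr//;
      by move=> /andP[? ?]; apply/andP; split; lra.
  rewrite !lebesgue_measure_itv/= !lte_fin xy ltr_nM2r ?invr_lt0// ltrD2r xy.
  by rewrite ltr0_norm// -!EFinD -EFinM; congr EFin; field.
Qed.

(** A slope of absolute value at most 1 compresses lengths, so the image of
    Lebesgue measure under the affine map dominates Lebesgue measure, and a
    lower bound [c] on the density survives the change of variable. *)
Lemma density_lower_bound (F : probability (measurableTypeR R) R) (f : R -> R)
    (J : set R) (a b c : R) (G A : set R) :
  measurable (J : set (measurableTypeR R)) -> density_on F f J -> (0 <= c)%R ->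
  (0 < `|a| <= 1)%R -> measurable (G : set (measurableTypeR R)) ->
  (forall r, G (b + a * r)%R -> J r /\ (c <= f r)%R) ->
  measurable (A : set (measurableTypeR R)) ->
  c%:E * lambda (A `&` G) <= F ((fun r => b + a * r)%R @^-1` A).
Proof.
move=> mJ [mf f0 dens] c0 /andP[a_gt0 a_le1] mG Gf mA.
pose B : set (measurableTypeR R) := (fun r => b + a * r)%R @^-1` (A `&` G).
have mAG : measurable (A `&` G : set (measurableTypeR R)) by exact: measurableI.
have mpre (D : set (measurableTypeR R)) : measurable D ->
    measurable ((fun r => b + a * r)%R @^-1` D : set (measurableTypeR R)).
  by move=> mD; rewrite -[X in measurable X]setTI; exact: measurable_affine.
have mB : measurable B by exact: mpre.
have BJ : B `<=` J by move=> r [_ /Gf[]].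
have fB : c%:E * lambda B <= F B.
  rewrite dens// -integral_cst//; apply: ge0_le_integral => //=.
  - by apply/measurable_EFinP; exact: measurable_funS mJ BJ mf.
  - by move=> r [_ /Gf[_]]; rewrite lee_fin.
apply: (@le_trans _ _ (F B)); last first.
  by apply: le_measure; rewrite ?inE//; [exact: mpre|move=> r []].
apply: le_trans fB; apply: lee_pmul => //.
rewrite (@lebesgue_measure_affine a b (A `&` G))//; last by rewrite -normr_gt0.
by rewrite -[leRHS]mul1e lee_pmul// lee_fin.
Qed.

Import HBNNSimple.

(** Some simple function below [g] has a positive integral, hence some positive
    value [c] taken on a set of positive measure. *)
Lemma level_set_of_integral_gt0 (D : set R) (g : R -> R) :
  measurable (D : set (measurableTypeR R)) ->
  0 < \int[lambda]_(z in D) (g z)%:E ->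
  exists (c : R) (G : set R), [/\ (0 < c)%R,
    measurable (G : set (measurableTypeR R)), 0 < lambda G, G `<=` D &
    forall z, G z -> (c <= g z)%R].
Proof.
move=> mD; rewrite integralE => int_gt0.
have : 0 < \int[lambda]_(z in D) ((EFin \o g)^\+)%E z.
  apply: lt_le_trans int_gt0 _.
  by rewrite -[leRHS]sube0; apply: leeB => //; exact: integral_ge0.
rewrite ge0_integralE//= => /ereal_sup_gt[_ [h/= hg] <-].
rewrite sintegralE => sum_gt0.
have [x x_gt0 hx_gt0] : exists2 x, (0 < x)%R & 0 < lambda (h @^-1` [set x]).
  apply: contrapT => nex; move: sum_gt0; apply/negP; rewrite -leNgt.
  rewrite fsbig1// => x _; have [x0|x0|->] := ltgtP x 0%R; last by rewrite mul0e.
  - by rewrite preimage_nnfun0// measure0 mule0.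
  - apply/eqP; rewrite mule_eq0 eqe (gt_eqF x0)/=.
    apply: contra_notT nex => h0; exists x => //.
    by rewrite lt0e h0 measure_ge0.
have hxE z : h z = x -> D z /\ (x <= g z)%R.
  move=> hz; have := hg z; rewrite hz patchE; case: ifPn => [/set_mem Dz|_].
    rewrite funeposE/= le_max !lee_fin => /orP[//|]; lra.
  by rewrite lee_fin leNgt x_gt0.
exists x, (h @^-1` [set x]); split => //.
- by move=> z /hxE[].
- by move=> z /hxE[].
Qed.

End affine_change.

(** * The transition kernel of the chain *)

Section chain_kernel.
Context (R : realType).
Notation S := (measurableTypeR R).

Definition clamp (x : R) : R := Num.max 0 (Num.min 1 x).

Lemma clamp_itv x : 0 <= clamp x <= 1.
Proof. by rewrite /clamp le_max lexx/= ge_max ler01 ge_min lexx. Qed.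

Lemma clamp_id x : 0 <= x <= 1 -> clamp x = x.
Proof. by move=> /andP[x0 x1]; rewrite /clamp min_r// max_r. Qed.

Lemma measurable_clamp : measurable_fun (setT : set S) (clamp : S -> S).
Proof.
have h : measurable_fun (setT : set R) (clamp : R -> R).
  apply: measurable_maxr => //; exact: measurable_minr.
exact: h.
Qed.

Variable p : R -> R.
Hypothesis mp : measurable_fun (`[0, 1]%classic : set R) p.
Hypothesis p01 : forall x, 0 <= x <= 1 -> 0 <= p x <= 1.

Definition step_map (xv : S * (R * (R * R))) : S :=
  chain_step p xv.1 xv.2.1 xv.2.2.1 xv.2.2.2.

Lemma chain_stepE (x l r u : R) : chain_step p x l r u =
  if u < (p \_ `[0, 1]) x then x - x * l else x + (1 - x) * r.
Proof. by rewrite /chain_step; case: ifP => _ /=; ring. Qed.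

Lemma measurable_step_map : measurable_fun setT step_map.
Proof.
have mpT : measurable_fun (setT : set S) (p \_ `[0, 1] : S -> R).
  have h : measurable_fun (setT : set R) (p \_ `[0, 1]).
    by apply/(measurable_restrictT _ _).1 => //; exact: measurable_itv.
  exact: h.
have mx : measurable_fun setT (fun xv : S * (R * (R * R)) => xv.1 : R).
  have h : measurable_fun setT (fun xv : S * (R * (R * R)) => xv.1 : S).
    exact: measurable_fst.
  exact: h.
have mv : measurable_fun setT (fun xv : S * (R * (R * R)) => xv.2).
  exact: measurable_snd.
have ml : measurable_fun setT (fun xv : S * (R * (R * R)) => xv.2.1).
  exact: measurableT_comp measurable_fst mv.
have mr : measurable_fun setT (fun xv : S * (R * (R * R)) => xv.2.2.1).
  exact: measurableT_comp measurable_fst (measurableT_comp measurable_snd mv).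
have mu : measurable_fun setT (fun xv : S * (R * (R * R)) => xv.2.2.2).
  exact: measurableT_comp measurable_snd (measurableT_comp measurable_snd mv).
have h : measurable_fun setT (fun xv : S * (R * (R * R)) =>
    if xv.2.2.2 < (p \_ `[0, 1]) xv.1 then xv.1 - xv.1 * xv.2.1 : R
    else xv.1 + (1 - xv.1) * xv.2.2.1 : R).
  apply: measurable_fun_ifT.
  - apply: measurable_fun_ltr => //.
    exact: (measurableT_comp mpT (measurable_fst)).
  - by apply: measurable_funB => //; exact: measurable_funM.
  - apply: measurable_funD => //; apply: measurable_funM => //.
    exact: measurable_funB.
rewrite (_ : step_map = fun xv : S * (R * (R * R)) =>
    if xv.2.2.2 < (p \_ `[0, 1]) xv.1 then xv.1 - xv.1 * xv.2.1 : R
    else xv.1 + (1 - xv.1) * xv.2.2.1 : R).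
  exact: h.
by apply/funext => xv; rewrite /step_map chain_stepE.
Qed.

Variable noise_law : giry (R * (R * R))%type R.

Lemma measurable_step_from x :
  measurable_fun setT (fun v => step_map (clamp x, v)).
Proof.
apply: (measurableT_comp measurable_step_map).
by apply: measurable_fun_pair => //; exact: measurable_cst.
Qed.

(** Clamping the state makes every property that holds for starting points in
    [0, 1] hold for all real starting points. *)
Definition chain_kernel (x : S) : giry S R :=
  giry_map (measurable_step_from x) noise_law.

Lemma measurable_chain_kernel : measurable_fun setT chain_kernel.
Proof.
apply: measurable_giry_codensity => // B mB.
have mphiB : measurable (step_map @^-1` B).
  by rewrite -[X in measurable X]setTI; exact: measurable_step_map.
rewrite (_ : chain_kernel ^~ B =
    (noise_law \o xsection (step_map @^-1` B)) \o clamp).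
  apply: (measurableT_comp (f := noise_law \o xsection (step_map @^-1` B)))
    measurable_clamp.
  exact: measurable_fun_xsection.
apply/funext => x /=; rewrite /chain_kernel/= /giry_map/= /pushforward.
by congr (noise_law _); apply/seteqP; split => v; rewrite /xsection/= inE.
Qed.

End chain_kernel.

Section uniform.
Context (R : realType).
Local Open Scope ereal_scope.

Lemma uniform_prob_lt (q : R) : (0 <= q <= 1)%R ->
  uniform_prob (@ltr01 R) `]-oo, q[%classic = q%:E.
Proof.
move=> /andP[q0 q1]; rewrite /uniform_prob integral_uniform_pdf.
rewrite (eq_integral (cst 1)); last first.
  by move=> x; rewrite inE/= => -[_]; rewrite in_itv/= /uniform_pdf => ->;
    rewrite subr0 invr1.
rewrite (_ : _ `&` _ = `[0%R, q[%classic); last first.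
  apply/seteqP; split => x /=; rewrite !in_itv/=.
    by move=> [-> /andP[-> _]].
  by move=> /andP[-> xq]; rewrite xq; split => //=; exact/ltW/(lt_le_trans xq).
rewrite integral_cst//= mul1e lebesgue_measure_itv/= lte_fin.
by case: ltgtP q0 => //= [_|<-] _; rewrite ?oppr0 ?adde0.
Qed.

Lemma uniform_prob_ge (q : R) : (0 <= q <= 1)%R ->
  uniform_prob (@ltr01 R) `[q, +oo[%classic = (1 - q)%:E.
Proof.
by move=> q01; rewrite -setCitvl probability_setC// [X in 1 - X]uniform_prob_lt.
Qed.

End uniform.

Section moves.
Context (R : realType) (FL FR : probability (measurableTypeR R) R).
Variables (p : R -> R) (mp : measurable_fun (`[0, 1]%classic : set R) p).
Hypothesis p01 : forall x, 0 <= x <= 1 -> 0 <= p x <= 1.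
Context (d : measure_display) (T : measurableType d) (P : probability T R).
Variables (Ls Rs Us : nat -> {RV P >-> R}).
Hypothesis driving : driving_sequences FL FR Ls Rs Us.
Local Open Scope ereal_scope.

Notation K := (chain_kernel mp (noise_law Ls Rs Us)).

Lemma noise_lawX (B1 B2 B3 : set R) : measurable B1 -> measurable B2 ->
  measurable B3 ->
  noise_law Ls Rs Us (B1 `*` (B2 `*` B3)) =
  FL B1 * (FR B2 * uniform_prob (@ltr01 R) B3).
Proof.
have [lawL lawR lawU _] := driving; move=> mB1 mB2 mB3.
rewrite [LHS]product_measure1E//; last exact: measurableX.
rewrite /= [X in _ * X]product_measure1E//.
by congr (_ * (_ * _)); [exact: lawL|exact: lawR|exact: lawU].
Qed.

Lemma measurable_affine_preimage (a b : R) (A : set (measurableTypeR R)) :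
  measurable A ->
  measurable ((fun r => b + a * r)%R @^-1` A : set (measurableTypeR R)).
Proof.
by move=> mA; rewrite -[X in measurable X]setTI; exact: measurable_affine.
Qed.

(** Each way of reaching [A] is bounded below by the probability of a product
    event of the noise. *)
Lemma chain_kernel_rectangle (x : R) (A : set (measurableTypeR R))
    (B1 B2 B3 : set R) : measurable B1 -> measurable B2 -> measurable B3 ->
  measurable A ->
  (forall l r u, B1 l -> B2 r -> B3 u -> A (chain_step p (clamp x) l r u)) ->
  FL B1 * (FR B2 * uniform_prob (@ltr01 R) B3) <= K x A.
Proof.
move=> mB1 mB2 mB3 mA BA; rewrite -(noise_lawX mB1 mB2 mB3).
apply: (@le_measure _ _ _ (noise_law Ls Rs Us)); rewrite ?inE.
- by apply: measurableX => //; exact: measurableX.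
- by rewrite -[X in measurable X]setTI; exact: measurable_step_from.
- by move=> [l [r u]] /= [? [? ?]]; exact: BA.
Qed.

Lemma chain_kernel_left (x : R) (A : set (measurableTypeR R)) :
  (0 <= x <= 1)%R -> measurable A ->
  (p x)%:E * FL ((fun l => x + (- x) * l)%R @^-1` A) <= K x A.
Proof.
move=> x01 mA; have mB := measurable_affine_preimage (- x) x mA.
have FRT : FR setT = 1 by exact: probability_setT.
have -> : (p x)%:E * FL ((fun l => x + (- x) * l)%R @^-1` A) =
    FL ((fun l => x + (- x) * l)%R @^-1` A) *
      (FR setT * uniform_prob (@ltr01 R) `]-oo, p x[%classic).
  by rewrite FRT mul1e uniform_prob_lt ?p01// muleC.
apply: chain_kernel_rectangle => // l r u Al _; rewrite /= in_itv/= => up.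
rewrite clamp_id// chain_stepE patchE mem_set/= ?in_itv//= up.
by move: Al; rewrite /preimage/= mulNr.
Qed.

Lemma chain_kernel_right (x : R) (A : set (measurableTypeR R)) :
  (0 <= x <= 1)%R -> measurable A ->
  (1 - p x)%:E * FR ((fun r => x + (1 - x) * r)%R @^-1` A) <= K x A.
Proof.
move=> x01 mA; have mB := measurable_affine_preimage (1 - x) x mA.
have FLT : FL setT = 1 by exact: probability_setT.
have -> : (1 - p x)%:E * FR ((fun r => x + (1 - x) * r)%R @^-1` A) =
    FL setT * (FR ((fun r => x + (1 - x) * r)%R @^-1` A) *
      uniform_prob (@ltr01 R) `[p x, +oo[%classic).
  by rewrite FLT mul1e uniform_prob_ge ?p01// muleC.
apply: chain_kernel_rectangle => // l r u _ Ar; rewrite /= in_itv/= andbT => up.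
by rewrite clamp_id// chain_stepE patchE mem_set/= ?in_itv//= ltNge up.
Qed.

End moves.

(** * The laws of the chain evolve by its kernel *)

Section concentrated.
Context d (X : measurableType d) (R : realType).
Local Open Scope ereal_scope.

Lemma integral_concentrated (mu : {measure set X -> \bar R}) (D : set X)
    (f g : X -> \bar R) : measurable D -> mu (~` D) = 0 ->
  measurable_fun setT f -> measurable_fun setT g ->
  (forall x, D x -> f x = g x) -> \int[mu]_x f x = \int[mu]_x g x.
Proof.
move=> mD muD mf mg fg; apply: ae_eq_integral => //.
exists (~` D); split => //; first exact: measurableC.
by move=> x /= nfg Dx; apply: nfg => _; exact: fg.
Qed.

Lemma integral_concentrated_on (mu : {measure set X -> \bar R}) (D : set X)
    (f : X -> \bar R) : measurable D -> mu (~` D) = 0 ->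
  measurable_fun setT f ->
  \int[mu]_(x in D) f x = \int[mu]_x f x.
Proof.
move=> mD muD mf; rewrite integral_mkcond; apply: (integral_concentrated mD muD) => //.
  by apply/(measurable_restrictT _ mD).1; exact: measurable_funTS.
by move=> x Dx; rewrite patchE mem_set.
Qed.

End concentrated.

Section chain_evolution.
Context (R : realType) (FL FR : probability (measurableTypeR R) R).
Hypothesis FL01 : FL `[0, 1]%classic = 1%E.
Hypothesis FR01 : FR `[0, 1]%classic = 1%E.
Variables (p : R -> R) (mp : measurable_fun (`[0, 1]%classic : set R) p).
Context (d : measure_display) (T : measurableType d) (P : probability T R).
Variables (Ls Rs Us : nat -> {RV P >-> R}).
Hypothesis driving : driving_sequences FL FR Ls Rs Us.
Local Open Scope ereal_scope.

Notation S := (measurableTypeR R).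
Notation K := (chain_kernel mp (noise_law Ls Rs Us)).
Notation unit_itv := (`[0%R, 1%R]%classic : set (measurableTypeR R)).

Lemma measurable_unit_itv : measurable unit_itv.
Proof. exact: measurable_itv. Qed.

Lemma chain_kernel_setT x : K x setT = 1.
Proof.
rewrite /chain_kernel/= /giry_map/= /pushforward preimage_setT.
rewrite -!setXTT (noise_lawX driving)//.
rewrite [X in X * _](_ : _ = 1); last exact: probability_setT.
rewrite [X in _ * (X * _)](_ : _ = 1); last exact: probability_setT.
rewrite [X in _ * (_ * X)](_ : _ = 1); last exact: probability_setT.
by rewrite !mul1e.
Qed.

Lemma chain_kernel_unit_itv x : K x unit_itv = 1.
Proof.
apply/eqP; rewrite eq_le; apply/andP; split.
  by rewrite -(chain_kernel_setT x); apply: le_measure; rewrite ?inE.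
have h : FL unit_itv * (FR unit_itv * uniform_prob (@ltr01 R) setT) <= K x unit_itv.
  apply: (chain_kernel_rectangle mp driving) => //.
  move=> l r u /=; rewrite !in_itv/= => /andP[l0 l1] /andP[r0 r1] _.
  have /andP[x0 x1] := clamp_itv x; rewrite chain_stepE.
  by case: ifP => _; apply/andP; split; nra.
apply: le_trans h; rewrite FL01 FR01 !mul1e.
by rewrite [leRHS](_ : _ = 1)//; exact: probability_setT.
Qed.

Lemma measurable_chain_kernel_ev A : measurable A ->
  measurable_fun (setT : set S) (fun x => K x A).
Proof.
move=> mA.
apply: (measurableT_comp (f := (giry_ev (T := S) ^~ A))
  (g := chain_kernel mp (noise_law Ls Rs Us))).
  exact: measurable_giry_ev.
exact: measurable_chain_kernel.
Qed.

Let driving' : [/\ mutually_independent (gather3 Ls Rs Us),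
  forall n, has_law (Ls n) (distribution P (Ls 0%N)),
  forall n, has_law (Rs n) (distribution P (Rs 0%N)) &
  forall n, has_law (Us n) (distribution P (Us 0%N))].
Proof.
have [lawL lawR lawU ind] := driving.
by split => // n A mA; rewrite ?lawL ?lawR ?lawU.
Qed.

(** A transparent term, so that [chain_giry] is convertible to the laws that
    [recursion_law] speaks of. *)
Definition measurable_chain x0 n :
    measurable_fun setT (chain p Ls Rs Us x0 n : T -> S) :=
  measurable_recursion (X := chain p Ls Rs Us x0) (measurable_step_map mp)
    (fun=> erefl x0) (fun _ _ => erefl) n.

Definition chain_giry x0 n : giry S R :=
  giry_map (measurable_chain x0 n) (P : giry T R).

Lemma chain_giry_setT x0 n : chain_giry x0 n setT = 1.
Proof. exact: probability_setT. Qed.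

(** The clamped and the unclamped steps agree on [0, 1], which carries the law
    of the state. *)
Lemma chain_giry_step x0 n A : measurable A ->
  chain_giry x0 n unit_itv = 1 ->
  chain_giry x0 n.+1 A = \int[chain_giry x0 n]_x K x A.
Proof.
have [ind idL idR idU] := driving'.
move=> mA conc; have mphiA : measurable (step_map p @^-1` A).
  by rewrite -[X in measurable X]setTI; exact: measurable_step_map.
transitivity (\int[chain_giry x0 n]_x
    (noise_law Ls Rs Us) [set v | A (step_map p (x, v))]).
  exact: (@recursion_law _ _ _ _ _ _ _ ind idL idR idU _ _ (step_map p)
    (chain p Ls Rs Us x0) x0 (measurable_step_map mp) (fun=> erefl x0)
    (fun _ _ => erefl) n A mA).
apply: (integral_concentrated measurable_unit_itv).
- suff : chain_giry x0 n (~` unit_itv) = 0 by [].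
  have : chain_giry x0 n setT =
      chain_giry x0 n unit_itv + chain_giry x0 n (~` unit_itv).
    rewrite -(setUv unit_itv); apply: measureU (setICr _).
      exact: measurable_unit_itv.
    by apply: measurableC; exact: measurable_unit_itv.
  rewrite conc chain_giry_setT.
  case: (chain_giry x0 n (~` unit_itv)) => [r| |]//= [r1].
  by congr EFin; lra.
- rewrite (_ : (fun x => _) =
      (noise_law Ls Rs Us \o xsection (step_map p @^-1` A))).
    exact: measurable_fun_xsection.
  apply/funext => x /=; congr (noise_law _ _ _ _).
  by apply/seteqP; split => v; rewrite /xsection/= inE.
- exact: measurable_chain_kernel_ev.
- move=> x; rewrite /= in_itv/= => x01.
  by rewrite /chain_kernel/= /giry_map/= /pushforward clamp_id.
Qed.

Lemma chain_giry_unit_itv x0 n : (0 <= x0 <= 1)%R ->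
  chain_giry x0 n unit_itv = 1.
Proof.
move=> x01; elim: n => [|n IHn].
  rewrite /chain_giry/= /giry_map/= /pushforward.
  rewrite [X in P X](_ : _ = setT) ?probability_setT//.
  by apply/seteqP; split => // w _ /=; rewrite in_itv.
rewrite (chain_giry_step measurable_unit_itv IHn).
rewrite (eq_integral (cst 1)); last by move=> x _; exact: chain_kernel_unit_itv.
by rewrite integral_cst// mul1e; exact: chain_giry_setT.
Qed.

Lemma chain_giry_evolution x0 : (0 <= x0 <= 1)%R ->
  evolution (measurable_chain_kernel mp (noise_law Ls Rs Us)) (chain_giry x0).
Proof.
move=> x01 n A mA; rewrite giry_bindE//; apply: chain_giry_step => //.
exact: chain_giry_unit_itv.
Qed.

Lemma chain_law1 (x : S) (A : set S) : (0 <= x <= 1)%R -> measurable A ->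
  chain_law p Ls Rs Us x 1 A = K x A.
Proof.
move=> x01 mA; rewrite -[LHS]/(chain_giry x 1 A) chain_giry_step//; last first.
  exact: chain_giry_unit_itv.
rewrite (eq_measure_integral (\d_x : {measure set S -> \bar R})).
  rewrite integral_dirac//; last exact: measurable_chain_kernel_ev.
  by rewrite diracT mul1e.
move=> B mB _; rewrite /chain_giry/= /giry_map/= /pushforward diracE.
have [xB|xB] := pselect (B x).
  rewrite mem_set// [X in P X](_ : _ = setT) ?probability_setT//.
  by apply/seteqP; split.
rewrite memNset// [X in P X](_ : _ = set0) ?measure0//.
by apply/seteqP; split.
Qed.

(** A law that is invariant under the kernel is carried by [0, 1] because the
    kernel sends every point there; this is the first half of [stationary]. *)
Lemma stationary_chain_kernel (Pi : probability S R) :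
  stationary (chain_law p Ls Rs Us) Pi <->
  forall A, measurable A -> \int[Pi]_x K x A = Pi A.
Proof.
have E : Pi unit_itv = 1 -> forall A, measurable A ->
    \int[Pi]_(x in `[0%R, 1%R]) chain_law p Ls Rs Us x 1%N A = \int[Pi]_x K x A.
  move=> Pi1 A mA; rewrite -(integral_concentrated_on measurable_unit_itv).
  - apply: eq_integral => x; rewrite inE/= in_itv/= => x01.
    exact: chain_law1.
  - suff : Pi (~` unit_itv) = 0 by [].
    rewrite probability_setC; last exact: measurable_unit_itv.
    by rewrite Pi1 subee.
  - exact: measurable_chain_kernel_ev.
split => [[Pi1 stat] A mA|stat]; first by rewrite -E// stat.
have Pi1 : Pi unit_itv = 1.
  rewrite -stat; last exact: measurable_unit_itv.
  rewrite (eq_integral (cst 1)); last by move=> x _; exact: chain_kernel_unit_itv.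
  by rewrite integral_cst// mul1e; exact: probability_setT.
by split => // A mA; rewrite E// stat.
Qed.

End chain_evolution.

(** * Two steps of the chain dominate a fixed measure *)

Section overlap.
Context (R : realType) (FL FR : probability (measurableTypeR R) R).
Variables (fL fR : R -> R) (delta s t : R).
Hypotheses (delta_gt0 : 0 < delta) (delta_s : delta < s) (t_delta : t < 1 - delta).
Hypothesis densL : density_on FL fL `]1 - t - delta, 1 - s[.
Hypothesis densR : density_on FR fR `]s - delta, t[.

Lemma left_quotient_itv (y z : R) : 1 - delta <= y <= 1 -> s < z < t ->
  1 - t - delta < (y - z) / y < 1 - s.
Proof.
move: delta_gt0 delta_s t_delta => ? ? ? /andP[y1 y2] /andP[z1 z2].
have y0 : 0 < y by lra.
have h1 : 0 <= (t + delta) * (y - (1 - delta)) by apply: mulr_ge0; lra.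
have h2 : 0 <= delta * (1 - delta - t) by apply: mulr_ge0; lra.
have h3 : 0 <= s * (1 - y) by apply: mulr_ge0; lra.
by rewrite ltr_pdivlMr// ltr_pdivrMr//; apply/andP; split; lra.
Qed.

Lemma right_quotient_itv (y z : R) : 0 <= y <= delta -> s < z < t ->
  s - delta < (z - y) / (1 - y) < t.
Proof.
move: delta_gt0 delta_s t_delta => ? ? ? /andP[y1 y2] /andP[z1 z2].
have y0 : 0 < 1 - y by lra.
have h1 : 0 <= (s - delta) * y by apply: mulr_ge0; lra.
have h2 : 0 <= y * (1 - t) by apply: mulr_ge0; lra.
by rewrite ltr_pdivlMr// ltr_pdivrMr//; apply/andP; split; lra.
Qed.

(** The infimum is a genuine lower bound only because the set of values is
    bounded below: all the quotients lie in the interval where [fL] is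
    nonnegative. *)
Lemma overlap_density_le_left (y z : R) : 1 - delta <= y <= 1 -> s < z < t ->
  overlap_density delta fL fR z <= fL ((y - z) / y).
Proof.
move=> y1 zst; rewrite /overlap_density ge_min; apply/orP; left.
apply: ge_inf; last by exists y => //=; rewrite in_itv.
have [_ fL0 _] := densL.
exists 0 => _ [y' /=] + <-; rewrite in_itv/= => y'1.
by apply: fL0; rewrite /= in_itv/=; exact: left_quotient_itv.
Qed.

Lemma overlap_density_le_right (y z : R) : 0 <= y <= delta -> s < z < t ->
  overlap_density delta fL fR z <= fR ((z - y) / (1 - y)).
Proof.
move=> y1 zst; rewrite /overlap_density ge_min; apply/orP; right.
apply: ge_inf; last by exists y => //=; rewrite in_itv.
have [_ fR0 _] := densR.
exists 0 => _ [y' /=] + <-; rewrite in_itv/= => y'1.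
by apply: fR0; rewrite /= in_itv/=; exact: right_quotient_itv.
Qed.

End overlap.

Section minorization.
Context (R : realType) (FL FR : probability (measurableTypeR R) R).
Hypothesis FL01 : FL `[0, 1]%classic = 1%E.
Hypothesis FR01 : FR `[0, 1]%classic = 1%E.
Variables (p : R -> R) (mp : measurable_fun (`[0, 1]%classic : set R) p).
Hypothesis p01 : forall x, 0 <= x <= 1 -> 0 <= p x <= 1.
Context (d : measure_display) (T : measurableType d) (P : probability T R).
Variables (Ls Rs Us : nat -> {RV P >-> R}).
Hypothesis driving : driving_sequences FL FR Ls Rs Us.
Variable delta : R.
Hypothesis delta_bounds : 0 < delta < 1 / 2.

Notation K := (chain_kernel mp (noise_law Ls Rs Us)).
Notation lambda := (@lebesgue_measure R).

Definition edges : set (measurableTypeR R) :=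
  `[0, delta]%classic `|` `[1 - delta, 1]%classic.

Lemma measurable_edges : measurable edges.
Proof. by apply: measurableU; exact: measurable_itv. Qed.

Lemma edge_moves_probable :
  sup [set Num.max (p x) (1 - p (1 - x)) | x in `[0, delta]] < 1 ->
  exists2 eta, 0 < eta &
    (forall y, 0 <= y <= delta -> eta <= 1 - p y) /\
    (forall y, 1 - delta <= y <= 1 -> eta <= p y).
Proof.
set E := [set _ | _ in _]; have /andP[d0 d2] := delta_bounds.
have ubE : has_ubound E.
  exists 1 => _ [x /=] + <-; rewrite in_itv/= => /andP[x0 xd].
  have /p01/andP[_ h1] : 0 <= x <= 1 by apply/andP; split; lra.
  have /p01/andP[h2 _] : 0 <= 1 - x <= 1 by apply/andP; split; lra.
  by rewrite ge_max; apply/andP; split; lra.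
move=> E1; exists (1 - sup E); first lra.
have leE x : 0 <= x <= delta -> Num.max (p x) (1 - p (1 - x)) <= sup E.
  by move=> xd; apply: ub_le_sup => //; exists x.
split => y.
- by move=> /leE; rewrite ge_max => /andP[? _]; lra.
- move=> /andP[y1 y2]; have /leE : 0 <= 1 - y <= delta by apply/andP; split; lra.
  by rewrite ge_max subKr => /andP[_ ?]; lra.
Qed.

Lemma tail_gt0 (F : probability (measurableTypeR R) R) :
  F `[0, 1]%classic = 1%E -> (F `[0%R, (1 - delta)%R]%classic < 1)%E ->
  exists2 a : R, 0 < a & F `]1 - delta, 1]%classic = a%:E.
Proof.
move=> F01 Flt; have /andP[d0 d2] := delta_bounds.
have mI (i : interval R) : measurable ([set` i] : set (measurableTypeR R)).
  exact: measurable_itv.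
have F1 : (F `[0%R, (1 - delta)%R]%classic + F `](1 - delta)%R, 1%R]%classic = 1)%E.
  rewrite -measureU//.
    rewrite -F01; congr (F _); apply/seteqP; split => x /=; rewrite !in_itv/=.
      by move=> [|] /andP[? ?]; apply/andP; split; lra.
    move=> /andP[x0 x1]; have [xd|xd] := leP x (1 - delta); [left|right].
      by rewrite x0.
    by rewrite x1.
  apply/seteqP; split => x //=; rewrite !in_itv/= => -[/andP[_ xd] /andP[+ _]].
  by rewrite ltNge xd.
exists (fine (F `]1 - delta, 1]%classic)); last first.
  by rewrite fineK// (fin_num_measure F _ (mI `]1 - delta, 1])).
move: F1 Flt; rewrite -(fineK (fin_num_measure F _ (mI `[0, (1 - delta)]))).
rewrite -(fineK (fin_num_measure F _ (mI `]1 - delta, 1]))).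
by rewrite lte_fin => -[?] ?; lra.
Qed.

(** One of [p x] and [1 - p x] is at least 1/2. A fraction [l > 1 - delta] sends
    [x] to [x * (1 - l) < delta] if the move is to the left, and symmetrically
    to the right. *)
Lemma chain_kernel_to_edges :
  (maxe (FL `[0%R, (1 - delta)%R]%classic) (FR `[0%R, (1 - delta)%R]%classic) < 1)%E ->
  exists2 kappa : R, 0 < kappa &
    forall x, 0 <= x <= 1 -> (kappa%:E <= K x edges)%E.
Proof.
rewrite gt_max => /andP[FLlt FRlt]; have /andP[d0 d2] := delta_bounds.
have [a a0 aE] := tail_gt0 FL01 FLlt; have [b b0 bE] := tail_gt0 FR01 FRlt.
have mI (i : interval R) : measurable ([set` i] : set (measurableTypeR R)).
  exact: measurable_itv.
exists (Num.min a b / 2); first by rewrite divr_gt0// lt_min a0.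
move=> x x01; have /andP[x0 x1] := x01; have /andP[p0 p1] := p01 x01.
have [px|px] := leP (1 / 2) (p x).
- apply: le_trans (chain_kernel_left mp p01 driving x01 measurable_edges).
  apply: (@le_trans _ _ ((p x)%:E * a%:E)%E).
    rewrite -EFinM lee_fin mulrC ler_pM//.
    + by rewrite le_min (ltW a0) (ltW b0).
    + by lra.
    + by rewrite ge_min lexx.
  rewrite -aE; apply: lee_pmul => //.
  apply: le_measure; rewrite ?inE//.
    by apply: measurable_affine_preimage; exact: measurable_edges.
  move=> l /=; rewrite in_itv/= => /andP[l1 l2]; left; rewrite /= in_itv/=.
  by apply/andP; split; nra.
- apply: le_trans (chain_kernel_right mp p01 driving x01 measurable_edges).
  apply: (@le_trans _ _ ((1 - p x)%:E * b%:E)%E).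
    rewrite -EFinM lee_fin mulrC ler_pM//.
    + by rewrite le_min (ltW a0) (ltW b0).
    + by lra.
    + by rewrite ge_min lexx orbT.
  rewrite -bE; apply: lee_pmul => //; first by rewrite lee_fin subr_ge0.
  apply: le_measure; rewrite ?inE//.
    by apply: measurable_affine_preimage; exact: measurable_edges.
  move=> r /=; rewrite in_itv/= => /andP[r1 r2]; right; rewrite /= in_itv/=.
  by apply/andP; split; nra.
Qed.

(** A move from [y] to the right lands at [y + (1 - y) * r], so it lands at [z]
    when [r] is the quotient that occurs in [overlap_density]; its slope is
    [1 - y], and it is [- y] for a move to the left. *)
Lemma chain_kernel_from_edges (fL fR : R -> R) (s t eta c : R)
    (G A : set (measurableTypeR R)) :
  delta < s -> t < 1 - delta ->
  density_on FL fL `]1 - t - delta, 1 - s[ -> density_on FR fR `]s - delta, t[ ->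
  0 < eta -> (forall y, 0 <= y <= delta -> eta <= 1 - p y) ->
  (forall y, 1 - delta <= y <= 1 -> eta <= p y) ->
  0 < c -> measurable G -> G `<=` `]s, t[%classic ->
  (forall z, G z -> c <= overlap_density delta fL fR z) ->
  measurable A -> forall y, edges y -> 
  ((eta * c)%:E * lambda (A `&` G) <= K y A)%E.
Proof.
move=> ds td densL densR eta0 etaR etaL c0 mG Gst Gc mA y.
have /andP[d0 d2] := delta_bounds.
rewrite EFinM -muleA => -[|]; rewrite /= in_itv/= => y1; have /andP[? ?] := y1.
- have y01 : 0 <= y <= 1 by apply/andP; split; lra.
  apply: le_trans (chain_kernel_right mp p01 driving y01 mA).
  apply: lee_pmul; rewrite ?lee_fin ?etaR ?mule_ge0 ?lee_fin//; try exact: ltW.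
  apply: (density_lower_bound (measurable_itv _) densR) => //; first exact: ltW.
    rewrite normr_gt0 ger0_norm; last lra.
    by apply/andP; split; [apply: lt0r_neq0|]; lra.
  move=> r Gr; have := Gst _ Gr; rewrite /= in_itv/= => zst.
  have rE : (y + (1 - y) * r - y) / (1 - y) = r by field; lra.
  split; first by rewrite /= in_itv/= -rE; exact: (right_quotient_itv d0 ds td).
  apply: le_trans (Gc _ Gr) _; rewrite -[X in fR X]rE.
  exact: (overlap_density_le_right fL d0 ds td densR).
- have y01 : 0 <= y <= 1 by apply/andP; split; lra.
  apply: le_trans (chain_kernel_left mp p01 driving y01 mA).
  apply: lee_pmul; rewrite ?lee_fin ?etaL ?mule_ge0 ?lee_fin//; try exact: ltW.
  apply: (density_lower_bound (measurable_itv _) densL) => //; first exact: ltW.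
    rewrite normr_gt0 normrN ger0_norm; last lra.
    by apply/andP; split; [rewrite oppr_eq0; apply: lt0r_neq0|]; lra.
  move=> r Gr; have := Gst _ Gr; rewrite /= in_itv/= => zst.
  have rE : (y - (y + - y * r)) / y = r by field; lra.
  split; first by rewrite /= in_itv/= -rE; exact: (left_quotient_itv d0 ds td).
  apply: le_trans (Gc _ Gr) _; rewrite -[X in fL X]rE.
  exact: (overlap_density_le_left fR d0 ds td densL).
Qed.

End minorization.

Section two_step_minorization.
Context (R : realType) (FL FR : probability (measurableTypeR R) R).
Hypothesis FL01 : FL `[0, 1]%classic = 1%E.
Hypothesis FR01 : FR `[0, 1]%classic = 1%E.
Variables (p : R -> R) (mp : measurable_fun (`[0, 1]%classic : set R) p).
Hypothesis p01 : forall x, 0 <= x <= 1 -> 0 <= p x <= 1.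
Context (d : measure_display) (T : measurableType d) (P : probability T R).
Variables (Ls Rs Us : nat -> {RV P >-> R}).
Hypothesis driving : driving_sequences FL FR Ls Rs Us.
Variable delta : R.
Hypothesis delta_bounds : 0 < delta < 1 / 2.
Hypothesis cond1 : sup [set Num.max (p x) (1 - p (1 - x)) | x in `[0, delta]] < 1.
Hypothesis cond2 :
  (maxe (FL `[0%R, (1 - delta)%R]%classic) (FR `[0%R, (1 - delta)%R]%classic) < 1)%E.
Hypothesis cond3 : exists s t : R,
  [/\ delta < s, s < t, t < 1 - delta &
    exists fL fR : R -> R,
      [/\ density_on FL fL `]1 - t - delta, 1 - s[,
          density_on FR fR `]s - delta, t[ &
          (0 < \int[lebesgue_measure]_(z in `]s, t[)
                 (overlap_density delta fL fR z)%:E)%E]].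

Notation K := (chain_kernel mp (noise_law Ls Rs Us)).
Notation mK := (measurable_chain_kernel mp (noise_law Ls Rs Us)).

(** The first step reaches an edge with probability at least [kappa]; the second
    step then lands in [A `&` G] with probability at least [eta * c] times the
    Lebesgue measure of that set. *)
Lemma chain_kernel_minorization :
  exists2 nu : {finite_measure set (measurableTypeR R) -> \bar R},
    (0 < nu setT)%E &
    forall x A, measurable A -> (nu A <= giry_bind (K x) mK A)%E.
Proof.
have [eta eta0 [etaR etaL]] := edge_moves_probable p01 delta_bounds cond1.
have [kappa kappa0 toE] :=
  chain_kernel_to_edges FL01 FR01 mp p01 driving delta_bounds cond2.
have [s [t [ds st td [fL [fR [densL densR int_gt0]]]]]] := cond3.
have [c [G [c0 mG G0 Gst Gc]]] := level_set_of_integral_gt0 (measurable_itv _) int_gt0.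
have Goo : (lebesgue_measure (G : set (measurableTypeR R)) < +oo)%E.
  apply: (@le_lt_trans _ _ 
    (lebesgue_measure (`]s, t[%classic : set (measurableTypeR R)))).
    by apply: le_measure; rewrite ?inE//; exact: measurable_itv.
  by rewrite lebesgue_measure_itv/= lte_fin st -EFinB ltry.
have r0 : 0 <= kappa * (eta * c) by rewrite !mulr_ge0// ltW.
have nuE A : mscale (NngNum r0) (mfrestr mG Goo) A =
    ((kappa * (eta * c))%:E * lebesgue_measure (A `&` G))%E by [].
exists (mscale (NngNum r0) (mfrestr mG Goo)).
  rewrite [ltRHS]nuE setTI mule_gt0// lte_fin.
  by rewrite !mulr_gt0.
move=> x A mA; rewrite giry_bindE//.
have toEx : (kappa%:E <= K x (edges delta))%E.
  have := toE (clamp x) (clamp_itv x).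
  rewrite /chain_kernel/= /giry_map/= /pushforward.
  by rewrite (clamp_id (clamp_itv x)).
have fromE := chain_kernel_from_edges mp p01 driving delta_bounds ds td densL densR
  eta0 etaR etaL c0 mG Gst Gc mA.
have mE := measurable_edges delta.
have mKA : measurable_fun (setT : set (measurableTypeR R)) (fun y => K y A).
  exact: measurable_chain_kernel_ev.
rewrite [leLHS]nuE.
set m := ((eta * c)%:E * lebesgue_measure (A `&` G))%E in fromE *.
have m0 : (0 <= m)%E by rewrite mule_ge0// lee_fin mulr_ge0// ltW.
have mT : measurable ([set: measurableTypeR R]) by [].
have KA0 y : (0 <= K y A)%E by exact: measure_ge0.
apply: (@le_trans _ _ (m * K x (edges delta))%E).
  rewrite EFinM -muleA muleC; exact: (lee_wpmul2l m0 toEx).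
have intE : (\int[K x]_(y in edges delta) cst m y = m * K x (edges delta))%E.
  exact: integral_cst.
rewrite -[leLHS]intE.
apply: (@le_trans _ _ (\int[K x]_(y in edges delta) K y A)%E).
  apply: (ge0_le_integral (K x) mE (fun y _ => m0)).
  - exact: measurable_cst.
  - exact: measurable_funTS.
  - exact: fromE.
exact: (ge0_subset_integral (K x) mE mT mKA (fun y _ => KA0 y)).
Qed.

End two_step_minorization.

(** * Ergodicity *)

Lemma tv_dist_cvg0 (R : realType) (mu : nat -> set R -> \bar R)
    (Pi : set R -> \bar R) (r : R) : 0 <= r < 1 ->
  (forall j n A, measurable A -> (j.*2 <= n)%N ->
    (`|mu n A - Pi A| <= (r ^+ j)%:E)%E) ->
  tv_dist (mu n) Pi @[n --> \oo] --> 0%E.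
Proof.
move=> /andP[r0 r1] le_r.
have tv_ge0 n : (0 <= tv_dist (mu n) Pi)%E.
  apply: (@le_trans _ _ `|mu n set0 - Pi set0|%E) => //.
  by apply: ereal_sup_ubound; exists set0 => //=; exact: measurable0.
have tv_le j n : (j.*2 <= n)%N -> (tv_dist (mu n) Pi <= (r ^+ j)%:E)%E.
  by move=> jn; apply: ub_ereal_sup => _ [A /= mA <-]; exact: le_r.
have tv_fin n : tv_dist (mu n) Pi \is a fin_num.
  by rewrite ge0_fin_numE//; apply: le_lt_trans (tv_le 0%N n _) (ltry _).
apply/fine_cvgP; split; first exact: nearW.
have rcvg : r ^+ n @[n --> \oo] --> 0 by apply: cvg_expr; rewrite ger0_norm.
apply/cvgrPdist_le => eps eps0.
move/cvgrPdist_le : rcvg => /(_ _ eps0)[j _ /(_ j (leqnn j))] /= h.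
exists j.*2 => // n /= jn; rewrite sub0r normrN ger0_norm ?fine_ge0//.
apply: (@le_trans _ _ (r ^+ j)).
  by rewrite -lee_fin fineK//; exact: tv_le.
by apply: le_trans h; rewrite sub0r normrN ler_norm.
Qed.

Theorem lemma1 (R : realType) (FL FR : probability (measurableTypeR R) R)
    (FL01 : FL `[0, 1]%classic = 1%E) (FR01 : FR `[0, 1]%classic = 1%E)
    (p : R -> R) (mp : measurable_fun (`[0, 1]%classic : set R) p)
    (p01 : forall x, 0 <= x <= 1 -> 0 <= p x <= 1)
    (d : measure_display) (T : measurableType d) (P : probability T R)
    (Ls Rs Us : nat -> {RV P >-> R})
    (driving : driving_sequences FL FR Ls Rs Us)
    (delta : R) (delta_bounds : 0 < delta < 1 / 2)
    (cond1 : sup [set Num.max (p x) (1 - p (1 - x)) | x in `[0, delta]] < 1)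
    (cond2 : (maxe (FL `[0%R, (1 - delta)%R]%classic) (FR `[0%R, (1 - delta)%R]%classic) < 1)%E)
    (cond3 : exists s t : R,
      [/\ delta < s, s < t, t < 1 - delta &
        exists fL fR : R -> R,
          [/\ density_on FL fL `]1 - t - delta, 1 - s[,
              density_on FR fR `]s - delta, t[ &
              (0 < \int[lebesgue_measure]_(z in `]s, t[)
                     (overlap_density delta fL fR z)%:E)%E]]) :
  ergodic (chain_law p Ls Rs Us).
Proof.
have [nu nu_gt0 minor] := chain_kernel_minorization FL01 FR01 mp p01 driving
  delta_bounds cond1 cond2 cond3.
have [Pi [r [r01 stat uniq rate]]] :=
  doeblin (chain_kernel_setT mp driving) nu_gt0 minor.
have statE := stationary_chain_kernel FL01 FR01 mp driving.
exists Pi; split; first exact/statE.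
- by move=> Pi' /statE statPi'; exact: uniq.
- move=> x0 x01; apply: (tv_dist_cvg0 r01) => j n A mA jn.
  exact: (rate _ (chain_giry_evolution FL01 FR01 mp driving x01)
    (chain_giry_setT mp Ls Rs Us x0 0) j n A mA jn).
Qed.
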